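(* Let $A$ be an algebra with few automorphisms, with canonical grading $A=\bigoplus_{m\in\mathbb Z^r}A_{(m)}$, and let $A=\bigoplus_{n\in\mathbb Z^t}A_n$ be any algebra grading of $A$. Then there is a group homomorphism $\varphi:\mathbb Z^r\to\mathbb Z^t$ such that $A_n=\bigoplus_{m\in\mathbb Z^r:\ \varphi(m)=n}A_{(m)}$ for all $n\in\mathbb Z^t$.
   Context: $\Bbbk$ is a field of characteristic zero. Rational actions of a torus $(\Bbbk^\times)^r$ on an algebra $A$ by algebra automorphisms correspond bijectively to algebra gradings of $A$ by $\mathbb Z^r$ (homogeneous components being isotypic components of characters). An associative $\Bbbk$-algebra $A$ has few automorphisms if: (i) there is a finite dimensional $\mathrm{Aut}_{\rm Alg}A$-invariant subspace $V\subseteq A$ such that restriction $\mathrm{Aut}_{\rm Alg}A\to GL(V)$ is injective; (ii) the image is an algebraic subgroup of $GL(V)$; (iii) the action of $\mathrm{Aut}_{\rm Alg}A$ on $A$ is rational (union of finite dimensional rational submodules); (iv) the identity component $(\mathrm{Aut}_{\rm Alg}A)_0$ is isomorphic to a torus $(\Bbbk^\times)^r$. Fixing such an isomorphism, the canonical grading $A=\bigoplus_{m\in\mathbb Z^r}A_{(m)}$ is the grading induced by the rational action of $(\mathrm{Aut}_{\rm Alg}A)_0$. *)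

(* Defs.v *)
From HB Require Import structures.
From mathcomp Require Import all_boot all_order all_algebra.
From mathcomp Require Import mpoly.
Set Implicit Arguments. Unset Strict Implicit. Unset Printing Implicit Defensive.
Import GRing.Theory.
Local Open Scope ring_scope.

Section FewAut.
Variables (k : fieldType) (A : algType k).

Definition is_aut (f : A -> A) : Prop :=
  [/\ (forall (c : k) (x y : A), f (c *: x + y) = c *: f x + f y),
      (forall x y : A, f (x * y) = f x * f y),
      f 1 = 1 & bijective f].

Definition lin_free (d : nat) (b : 'I_d -> A) : Prop :=
  forall c : 'I_d -> k, \sum_i c i *: b i = 0 -> forall i, c i = 0.
Definition in_span (d : nat) (b : 'I_d -> A) (a : A) : Prop :=
  exists c : 'I_d -> k, a = \sum_i c i *: b i.

Definition rep (d : nat) (b : 'I_d -> A) (f : A -> A) (M : 'M[k]_d) : Prop :=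
  forall i, f (b i) = \sum_j M i j *: b j.

Definition mxv (d : nat) (M : 'M[k]_d) : 'I_(d * d) -> k := fun i => mxvec M 0 i.

(** regular function on Aut A, via the embedding into GL(V):
    p(entries) / det^N *)
Definition regular_aut (d : nat) (b : 'I_d -> A) (F : (A -> A) -> k) : Prop :=
  exists (p : {mpoly k[d * d]}) (N : nat),
    forall f M, is_aut f -> rep b f M -> F f = p.@[mxv M] / (\det M) ^+ N.

(** Zariski closed subsets of Aut A (through the embedding in GL(V)) *)
Definition zclosed_aut (d : nat) (b : 'I_d -> A) (Z : (A -> A) -> Prop) : Prop :=
  exists S : {mpoly k[d * d]} -> Prop,
    forall f, is_aut f ->
      (Z f <-> forall M, rep b f M -> forall p, S p -> p.@[mxv M] = 0).

Definition zconnected_aut (d : nat) (b : 'I_d -> A) (C : (A -> A) -> Prop) : Prop :=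
  forall Z1 Z2, zclosed_aut b Z1 -> zclosed_aut b Z2 ->
    (forall f, C f -> Z1 f \/ Z2 f) ->
    (forall f, C f -> Z1 f -> Z2 f -> False) ->
    (forall f, C f -> Z1 f) \/ (forall f, C f -> Z2 f).

Definition in_aut0 (d : nat) (b : 'I_d -> A) (f : A -> A) : Prop :=
  exists C : (A -> A) -> Prop,
    [/\ forall g, C g -> is_aut g, C id, zconnected_aut b C & C f].

Definition in_torus (r : nat) (t : 'I_r -> k) : Prop := forall i, t i != 0.
Definition tmul (r : nat) (t s : 'I_r -> k) : 'I_r -> k := fun i => t i * s i.

(** regular functions on the torus: Laurent polynomials *)
Definition regular_torus (r : nat) (g : ('I_r -> k) -> k) : Prop :=
  exists (p : {mpoly k[r]}) (N : nat),
    forall t, in_torus t -> g t = p.@[t] / (\prod_i t i) ^+ N.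

Definition regular_aut0 (d : nat) (b : 'I_d -> A) (F : (A -> A) -> k) : Prop :=
  exists (p : {mpoly k[d * d]}) (N : nat),
    forall f M, in_aut0 b f -> rep b f M -> F f = p.@[mxv M] / (\det M) ^+ N.

(** A has few automorphisms, witnessed by V = span b, with
    psi : (k^x)^r -> (Aut A)_0 a fixed isomorphism of algebraic groups *)
Definition few_automorphisms (d : nat) (b : 'I_d -> A) (r : nat)
    (psi : ('I_r -> k) -> A -> A) : Prop :=
  [/\
      lin_free b
      /\ (forall f, is_aut f -> exists M, rep b f M)
      /\ (forall f g M, is_aut f -> is_aut g -> rep b f M -> rep b g M -> f = g),
      (exists S : {mpoly k[d * d]} -> Prop,
        forall M : 'M[k]_d, M \in unitmx ->
          ((exists f, is_aut f /\ rep b f M) <->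
           (forall p, S p -> p.@[mxv M] = 0))),
      (forall a : A, exists (e : nat) (c : 'I_e -> A)
                            (F : 'I_e -> 'I_e -> (A -> A) -> k),
        [/\ lin_free c, in_span c a,
            forall i j, regular_aut b (F i j) &
            forall f i, is_aut f -> f (c i) = \sum_j F i j f *: c j]) &
      [/\ (forall t, in_torus t -> in_aut0 b (psi t))
          /\ (forall f, in_aut0 b f -> exists2 t, in_torus t & psi t = f),
          forall t s, in_torus t -> in_torus s -> psi t = psi s -> t = s,
          forall t s, in_torus t -> in_torus s ->
            psi (tmul t s) = psi t \o psi s,
          (exists F : 'I_d -> 'I_d -> ('I_r -> k) -> k,
             (forall i j, regular_torus (F i j)) /\
             forall t, in_torus t -> rep b (psi t) (\matrix_(i, j) F i j t)) &
          (exists H : 'I_r -> (A -> A) -> k,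
             (forall i, regular_aut0 b (H i)) /\
             forall t i, in_torus t -> H i (psi t) = t i)]].

Definition canon_comp (r : nat) (psi : ('I_r -> k) -> A -> A) (m : 'rV[int]_r)
    (a : A) : Prop :=
  forall t, in_torus t -> psi t a = (\prod_i t i ^ m 0 i) *: a.

Definition is_grading (t : nat) (G : 'rV[int]_t -> A -> Prop) : Prop :=
  [/\ forall n, G n 0,
      forall n (c : k) x y, G n x -> G n y -> G n (c *: x + y),
      forall n m x y, G n x -> G m y -> G (n + m) (x * y),
      forall a, exists (s : seq 'rV[int]_t) (f : 'rV[int]_t -> A),
        [/\ uniq s, forall n, n \in s -> G n (f n) & a = \sum_(n <- s) f n] &
      forall (s : seq 'rV[int]_t) (f : 'rV[int]_t -> A), uniq s ->
        (forall n, n \in s -> G n (f n)) -> \sum_(n <- s) f n = 0 ->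
        forall n, n \in s -> f n = 0].

End FewAut.

(* Main.v *)
(* A Z^t-grading is an action rho of the torus (k^x)^t.  Its image is an
   irreducible set of automorphisms through the identity, so it lies in the
   identity component (k^x)^r, and rho factors through a regular homomorphism
   (k^x)^t -> (k^x)^r.  By Dedekind's independence of characters the coordinates
   of this homomorphism are monomials, whose exponents give phi; the degree n
   part for rho is then the sum of the canonical components with phi(m) = n. *)
Require Import Defs.
From HB Require Import structures.
From mathcomp Require Import all_boot all_order all_algebra.
From mathcomp Require Import mpoly.
From Stdlib Require Import FunctionalExtensionality ClassicalEpsilon.
Import GRing.Theory.
Local Open Scope ring_scope.

Set Implicit Arguments.
Unset Strict Implicit.
Unset Printing Implicit Defensive.

(** * Nonroots and an element of infinite order in characteristic zero *)

Section CharZeroField.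
Variable k : fieldType.
Hypothesis char0 : [pchar k] =i pred0.

Lemma natr_inj : injective (fun n : nat => n%:R : k).
Proof.
have nat_eq0 := (pcharf0P k).1 char0.
move=> a c; wlog le_ac : a c / (a <= c)%N => [IH|] acE.
  by case: (leqP a c) => [/IH|/ltnW/IH] -> //.
apply/eqP; rewrite eqn_leq le_ac /= -subn_eq0 -nat_eq0 natrB //.
by rewrite -acE subrr.
Qed.

(** The natural numbers below [size P] stay distinct in [k], and they outnumber the roots that [P]
    can have. *)
Lemma poly_nonroot (P : {poly k}) : P != 0 -> exists x, P.[x] != 0.
Proof.
move=> Pn0; pose s : seq k := [seq j%:R | j <- iota 0 (size P)].
have us : uniq s by rewrite (map_inj_uniq natr_inj) iota_uniq.
have /allPn [x _ Px] : ~~ all (root P) s.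
  apply/negP => /(max_poly_roots Pn0) /(_ us).
  by rewrite size_map size_iota ltnn.
by exists x.
Qed.

Lemma two_neq0 : 2%:R != 0 :> k.
Proof. by rewrite ((pcharf0P k).1 char0). Qed.

(** In characteristic zero 2 has infinite multiplicative order, since it does so among the natural
    numbers. Its powers later tell characters apart. *)
Lemma exprz2_inj : injective (fun z : int => 2%:R ^ z : k).
Proof.
have exp2_1 j : 2%:R ^+ j = 1 :> k -> j = 0%N.
  by rewrite -natrX => /(@natr_inj _ 1%N)/eqP; rewrite -(expn0 2) eqn_exp2l => // /eqP.
move=> x y xy; apply/eqP; rewrite -subr_eq0.
have : 2%:R ^ (x - y) = 1 :> k.
  by rewrite expfzDr ?two_neq0 // xy -expfzDr ?two_neq0 // subrr.
case: (x - y) => j; first by move/exp2_1 => ->.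
by move=> /(congr1 (@GRing.inv _)); rewrite NegzE -exprnN invrK invr1 => /exp2_1.
Qed.

End CharZeroField.

(** * Monomial characters and regular functions on a torus *)

Section Torus.
Variables (k : fieldType) (r : nat).
Implicit Types (t s : 'I_r -> k) (m n : 'rV[int]_r) (F : ('I_r -> k) -> k).

Definition mon t m : k := \prod_i t i ^ m 0 i.

Lemma monD t m n : in_torus t -> mon t (m + n) = mon t m * mon t n.
Proof.
move=> tT; rewrite /mon -big_split; apply: eq_bigr => i _ /=.
by rewrite mxE expfzDr.
Qed.

Lemma monM t s m : mon (tmul t s) m = mon t m * mon s m.
Proof. by rewrite /mon -big_split; apply: eq_bigr => i _ /=; rewrite expfzMl. Qed.

Lemma mon0 t : mon t 0 = 1.
Proof. by rewrite /mon big1 // => i _; rewrite mxE expr0z. Qed.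

Lemma mon1 m : mon (fun=> 1) m = 1.
Proof. by rewrite /mon big1 // => i _; rewrite exp1rz. Qed.

Lemma mon_neq0 t m : in_torus t -> mon t m != 0.
Proof. by move=> tT; apply/prodf_neq0 => i _; rewrite expfz_neq0. Qed.

Lemma in_torus1 : in_torus (fun=> 1 : k) (r := r).
Proof. by move=> i; rewrite oner_eq0. Qed.

Lemma in_torusM t s : in_torus t -> in_torus s -> in_torus (tmul t s).
Proof. by move=> tT sT i; rewrite mulf_neq0. Qed.

Lemma tmulV t : in_torus t -> tmul t (fun i => (t i)^-1) = fun=> 1.
Proof. by move=> tT; apply: functional_extensionality => i; rewrite /tmul divff. Qed.

Lemma tmulC t s : tmul t s = tmul s t.
Proof. by apply: functional_extensionality => i; rewrite /tmul mulrC. Qed.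

Lemma tmul1 t : tmul (fun=> 1) t = t.
Proof. by apply: functional_extensionality => i; rewrite /tmul mul1r. Qed.

Lemma regular_ext F F' : (forall t, in_torus t -> F t = F' t) ->
  regular_torus F -> regular_torus F'.
Proof. by move=> FF' [p [N pN]]; exists p, N => t tT; rewrite -FF' // pN. Qed.

Lemma regular_cst (c : k) : regular_torus (fun _ : 'I_r -> k => c).
Proof. by exists c%:MP, 0%N => t _; rewrite mevalC expr0 divr1. Qed.

Let coordprod_neq0 t : in_torus t -> \prod_i t i != 0.
Proof. by move=> tT; apply/prodf_neq0 => i _. Qed.

Let meval_coordprod t : (\prod_i 'X_i : {mpoly k[r]}).@[t] = \prod_i t i.
Proof. by rewrite rmorph_prod; apply: eq_bigr => i _; rewrite /= mevalXU. Qed.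

Lemma regularD F F' : regular_torus F -> regular_torus F' ->
  regular_torus (fun t => F t + F' t).
Proof.
move=> [p [N pN]] [q [M qM]].
exists (p * (\prod_i 'X_i) ^+ M + q * (\prod_i 'X_i) ^+ N), (N + M)%N => t tT.
rewrite pN // qM // mevalD !mevalM !rmorphXn /= meval_coordprod exprD.
by rewrite addf_div ?expf_neq0 ?coordprod_neq0.
Qed.

Lemma regularM F F' : regular_torus F -> regular_torus F' ->
  regular_torus (fun t => F t * F' t).
Proof.
move=> [p [N pN]] [q [M qM]]; exists (p * q), (N + M)%N => t tT.
by rewrite pN // qM // mevalM exprD mulf_div.
Qed.

Lemma regular_sum (I : Type) (l : seq I) (P : pred I) (F : I -> ('I_r -> k) -> k) :
  (forall i, regular_torus (F i)) ->
  regular_torus (fun t => \sum_(i <- l | P i) F i t).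
Proof.
move=> Freg; elim: l => [|i l IHl].
  by apply: regular_ext (regular_cst 0) => t _; rewrite big_nil.
case Pi: (P i); last first.
  by apply: regular_ext IHl => t _; rewrite big_cons Pi.
by apply: regular_ext (regularD (Freg i) IHl) => t _; rewrite big_cons Pi.
Qed.

Lemma regular_prod (I : Type) (l : seq I) (P : pred I) (F : I -> ('I_r -> k) -> k) :
  (forall i, regular_torus (F i)) ->
  regular_torus (fun t => \prod_(i <- l | P i) F i t).
Proof.
move=> Freg; elim: l => [|i l IHl].
  by apply: regular_ext (regular_cst 1) => t _; rewrite big_nil.
case Pi: (P i); last first.
  by apply: regular_ext IHl => t _; rewrite big_cons Pi.
by apply: regular_ext (regularM (Freg i) IHl) => t _; rewrite big_cons Pi.
Qed.

Lemma regularX F N : regular_torus F -> regular_torus (fun t => F t ^+ N).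
Proof.
move=> Freg; apply: regular_ext (regular_prod (index_enum 'I_N) xpredT (fun=> Freg)).
by move=> t _; rewrite prodr_const card_ord.
Qed.

Lemma regular_coord (i : 'I_r) : regular_torus (fun t => t i).
Proof. by exists 'X_i, 0%N => t _; rewrite mevalXU expr0 divr1. Qed.

(** The inverse of a coordinate is the product of the other coordinates over the product of all, and
    the latter is the denominator allowed in [regular_torus]. *)
Lemma regular_coordV (i : 'I_r) : regular_torus (fun t => (t i)^-1).
Proof.
exists (\prod_(j | j != i) 'X_j), 1%N => t tT.
rewrite expr1 (bigD1 i (F := t)) //= rmorph_prod.
under eq_bigr do rewrite /= mevalXU.
rewrite invfM mulrCA divff ?mulr1 //.
by apply/prodf_neq0 => j _.
Qed.

Lemma regular_mon m : regular_torus (mon^~ m).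
Proof.
apply: regular_prod => i; case: (m 0 i) => n.
  by apply: regular_ext (regularX n (regular_coord i)).
apply: regular_ext (regularX n.+1 (regular_coordV i)) => t _.
by rewrite NegzE -exprnN exprVn.
Qed.

Lemma regular_meval (D : nat) (p : {mpoly k[D]}) (F : 'I_D -> ('I_r -> k) -> k) :
  (forall i, regular_torus (F i)) -> regular_torus (fun t => p.@[F^~ t]).
Proof.
move=> Freg; apply: (@regular_ext
    (fun t => \sum_(mu <- msupp p) p@_mu * \prod_i F i t ^+ mu i)).
  by move=> t _; rewrite mevalE.
apply: regular_sum => mu; apply: regularM; first exact: regular_cst.
by apply: regular_prod => i; apply: regularX.
Qed.

Lemma regular_det (D : nat) (M : ('I_r -> k) -> 'M[k]_D) :
  (forall i j, regular_torus (fun t => M t i j)) ->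
  regular_torus (fun t => \det (M t)).
Proof.
move=> Mreg; apply: regular_sum => s.
by apply: regularM; [exact: regular_cst | apply: regular_prod].
Qed.

Lemma regular_meval_mxv (D : nat) (p : {mpoly k[D * D]}) (M : ('I_r -> k) -> 'M[k]_D) :
  (forall i j, regular_torus (fun t => M t i j)) ->
  regular_torus (fun t => p.@[mxv (M t)]).
Proof.
move=> Mreg; apply: regular_meval (fun i t => mxv (M t) i) _ => i.
rewrite /mxv; case/mxvec_indexP: i => i j.
by apply: regular_ext (Mreg i j) => t _; rewrite mxvecE.
Qed.

(** Laurent polynomials with coefficients in [V], listed as pairs of exponent and coefficient.
    Exponents may repeat, so that adding two of them is concatenation. *)
Definition laurent (V : lmodType k) (f : ('I_r -> k) -> V) : Prop :=
  exists L : seq ('rV[int]_r * V),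
    forall t, in_torus t -> f t = \sum_(p <- L) mon t p.1 *: p.2.

(** Dividing by the [N]-th power of the product of all coordinates lowers every exponent by [N]. *)
Lemma laurent_regular (V : lmodType k) F (v : V) :
  regular_torus F -> laurent (fun t => F t *: v).
Proof.
move=> [p [N pN]].
pose e (mu : 'X_{1..r}) : 'rV[int]_r := \row_i ((mu i)%:Z - N%:Z).
exists [seq (e mu, p@_mu *: v) | mu <- msupp p] => t tT.
rewrite pN // big_map mevalE mulr_suml scaler_suml; apply: eq_bigr => mu _ /=.
rewrite scalerA [in RHS]mulrC -mulrA; congr (_ * _ *: _).
rewrite -prodrXl -prodf_div; apply: eq_bigr => i _.
by rewrite mxE expfzDr // -exprnN.
Qed.

Lemma laurent_sum (V : lmodType k) (I : Type) (l : seq I)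
    (f : I -> ('I_r -> k) -> V) :
  (forall i, laurent (f i)) -> laurent (fun t => \sum_(i <- l) f i t).
Proof.
move=> fL; elim: l => [|i l [L IHl]].
  by exists [::] => t _; rewrite !big_nil.
have [L' L'E] := fL i; exists (L' ++ L) => t tT.
by rewrite big_cons big_cat L'E // IHl.
Qed.

(** Independence of characters is about distinct exponents; this merges the terms whose labels
    coincide. *)
Lemma sum_group (V : lmodType k) (I T : eqType) (l : seq I) (e : I -> T)
    (h : T -> k) (x : I -> V) :
  \sum_(i <- l) h (e i) *: x i =
  \sum_(m <- undup (map e l)) h m *: \sum_(i <- l | e i == m) x i.
Proof.
under [RHS]eq_bigr do rewrite scaler_sumr big_mkcond.
rewrite exchange_big /= big_seq [RHS]big_seq; apply: eq_bigr => i il.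
under eq_bigr do rewrite eq_sym.
rewrite (bigD1_seq (e i)) ?undup_uniq ?mem_undup ?map_f //= eqxx big1 ?addr0 //.
by move=> m /negPf ->.
Qed.

Lemma laurentP (V : lmodType k) (f : ('I_r -> k) -> V) : laurent f ->
  exists (l : seq 'rV[int]_r) (x : 'rV[int]_r -> V), uniq l /\
    forall t, in_torus t -> f t = \sum_(m <- l) mon t m *: x m.
Proof.
move=> [L fE]; exists (undup (map fst L)), (fun m => \sum_(p <- L | p.1 == m) p.2).
split=> [|t tT]; first exact: undup_uniq.
by rewrite fE // sum_group.
Qed.

(** * Linear independence of characters *)

Section CharZero.
Hypothesis char0 : [pchar k] =i pred0.

(* The restrictions of the numerators to the line through s and s' are nonzero
   univariate polynomials, hence so is their product. *)
Lemma regular_nonvanishing F F' s s' :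
  regular_torus F -> regular_torus F' -> in_torus s -> in_torus s' ->
  F s != 0 -> F' s' != 0 -> exists t, [/\ in_torus t, F t != 0 & F' t != 0].
Proof.
move=> [p [N pN]] [q [M qM]] sT s'T; rewrite pN // qM // => Fs F's'.
(* The line is parametrized to pass through [s'] at 0 and through [s] at 1. *)
pose l i : {poly k} := (s i)%:P * 'X + (s' i)%:P * (1 - 'X).
pose P (h : {mpoly k[r]}) := \sum_(mu <- msupp h) (h@_mu)%:P * \prod_i l i ^+ mu i.
have PE h x : (P h).[x] = h.@[fun i => (l i).[x]].
  rewrite horner_sum mevalE; apply: eq_bigr => mu _.
  rewrite hornerM hornerC horner_prod; congr (_ * _).
  by apply: eq_bigr => i _; rewrite horner_exp.
have l1 : (fun i => (l i).[1]) = s.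
  by apply: functional_extensionality => i; rewrite !hornerE subrr mulr0 addr0.
have l0 : (fun i => (l i).[0]) = s'.
  by apply: functional_extensionality => i; rewrite !hornerE subr0 mulr1.
have Pp0 : P p != 0.
  apply: contra_neq Fs => Pp0.
  by rewrite -l1 -PE Pp0 horner0 mul0r.
have Pq0 : P q != 0.
  apply: contra_neq F's' => Pq0.
  by rewrite -l0 -PE Pq0 horner0 mul0r.
(* The coordinates of the line enter the product too, so that the point found lies in the torus. *)
have l_neq0 : \prod_i l i != 0.
  apply/prodf_neq0 => i _; apply: contra_neq (sT i) => li0.
  by rewrite -l1 li0 horner0.
have [x] := poly_nonroot char0 (mulf_neq0 l_neq0 (mulf_neq0 Pp0 Pq0)).
rewrite !hornerM !mulf_eq0 !negb_or horner_prod !PE => /and3P [/prodf_neq0 lx px qx].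
have lT : in_torus (fun i => (l i).[x]) by move=> i; apply: lx.
exists (fun i => (l i).[x]).
by split; rewrite ?pN ?qM // mulf_neq0 // invr_neq0 // expf_neq0 // coordprod_neq0.
Qed.

Lemma mon_separates m n : m != n -> exists2 t, in_torus t & mon t m != mon t n.
Proof.
move=> mn; have [i mni] : exists i, m 0 i != n 0 i.
  apply/existsP; apply: contra_neqT mn; rewrite negb_exists => /forallP mn.
  by apply/rowP => i; apply/eqP; have := mn i; rewrite negbK.
(* Only a coordinate at which the exponents differ is moved, and it is given the value 2, of
   infinite order. *)
exists (fun j => if j == i then 2%:R else 1).
  by move=> j; case: ifP; rewrite ?oner_eq0 ?(two_neq0 char0).
have monE j : mon (fun j => if j == i then 2%:R else 1) j = 2%:R ^ j 0 i.
  rewrite /mon (bigD1 i) //= eqxx big1 ?mulr1 // => c /negPf ->.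
  by rewrite exp1rz.
by rewrite !monE (inj_eq (exprz2_inj char0)).
Qed.

(* Dedekind's argument, carried out modulo the subspace W. *)
Lemma mon_independent_mod (V : lmodType k) (W : V -> Prop) (l : seq 'rV[int]_r)
    (x : 'rV[int]_r -> V) :
  (forall (c : k) v w, W v -> W w -> W (c *: v + w)) -> uniq l ->
  (forall t, in_torus t -> W (\sum_(m <- l) mon t m *: x m)) ->
  forall m, m \in l -> W (x m).
Proof.
move=> Wlin.
have WZ c v : W v -> W (c *: v).
  move=> Wv; have W0 : W 0 by rewrite -(addNr v) -scaleN1r; apply: Wlin.
  by rewrite -[_ *: _]addr0; apply: Wlin.
elim: l x => [//|m0 l IHl] x /= /andP [m0l ul] WS.
have Wx m : m \in l -> W (x m).
  move=> ml; have m_m0 : m != m0 by apply: contraNneq m0l => <-.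
  have [s sT sm] := mon_separates m_m0.
  rewrite -[x m](scalerK (a := mon s m - mon s m0)) ?subr_eq0 //.
  apply: WZ; apply: (IHl (fun m => (mon s m - mon s m0) *: x m)) => // t tT.
  (* The combination at [tmul s t] minus [mon s m0] times the one at [t] has no [m0] term, and
     multiplies each remaining [x n] by [mon s n - mon s m0]. *)
  have := Wlin (- mon s m0) _ _ (WS t tT) (WS _ (in_torusM sT tT)).
  rewrite !big_cons scalerDr addrACA !scaler_sumr -big_split /= scalerA mulNr.
  rewrite monM mulrC scaleNr addNr add0r; congr W; apply: eq_bigr => n _.
  rewrite !scalerA -scalerDl monM mulrBr addrC mulNr.
  by congr ((_ - _) *: _); apply: mulrC.
move=> m; rewrite inE => /orP [/eqP -> {m}|/Wx //].
(* Once the tail lies in [W], evaluation at the identity of the torus isolates [x m0]. *)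
have := WS _ in_torus1; rewrite big_cons mon1 scale1r => WS1.
suff Wl : W (\sum_(m <- l) mon (fun=> 1) m *: x m).
  have := Wlin (-1) _ _ Wl WS1.
  by rewrite scaleN1r addrCA addNr addr0.
have W0 : W 0 by have := WZ 0 _ WS1; rewrite scale0r.
rewrite big_seq; apply: big_ind => // [v w Wv Ww|m ml].
  by rewrite -[v]scale1r; apply: Wlin.
by apply: WZ; apply: Wx.
Qed.

Lemma mon_independent (V : lmodType k) (l : seq 'rV[int]_r) (x : 'rV[int]_r -> V) :
  uniq l -> (forall t, in_torus t -> \sum_(m <- l) mon t m *: x m = 0) ->
  forall m, m \in l -> x m = 0.
Proof.
apply: (mon_independent_mod (W := eq^~ 0)) => c v w -> ->.
by rewrite scaler0 addr0.
Qed.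

(** Expand [F] as a Laurent polynomial with coefficients [c]. Comparing coefficients in [s] in the
    multiplicativity identity gives [mon t m * c m = F t * c m], and some [c m] is nonzero because
    [F] does not vanish at the identity. *)
Lemma regular_character F : regular_torus F ->
  (forall t s, in_torus t -> in_torus s -> F (tmul t s) = F t * F s) ->
  F (fun=> 1) != 0 -> exists m, forall t, in_torus t -> F t = mon t m.
Proof.
move=> Freg FM F1; have [l [c [ul FE]]] := laurentP (laurent_regular (1 : k^o) Freg).
have {}FE t : in_torus t -> F t = \sum_(m <- l) mon t m * c m.
  by move=> tT; have := FE t tT; rewrite -[_ *: 1]/(_ * 1) mulr1.
have [m ml cm] : exists2 m, m \in l & c m != 0.
  apply/hasP; apply: contraNT F1 => /hasPn c0.
  rewrite (FE _ in_torus1) big_seq big1 // => m ml.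
  by have := c0 m ml; rewrite negbK => /eqP ->; rewrite mulr0.
exists m => t tT; apply/eqP; rewrite eq_sym -subr_eq0.
suff /eqP : (mon t m - F t) * c m = 0 by rewrite mulf_eq0 (negPf cm) orbF.
apply: (mon_independent (V := k^o) (x := fun m => (mon t m - F t) * c m) ul _ ml).
move=> s sT; have /eqP := FM t s tT sT.
rewrite -subr_eq0 (FE _ (in_torusM tT sT)) (FE s) // mulr_sumr -sumrB => /eqP FE0.
rewrite -[RHS]FE0; apply: eq_bigr => n _; rewrite -[_ *: _]/(_ * _) mulrCA mulrBl monM.
by rewrite -[in RHS]mulrA.
Qed.

End CharZero.
End Torus.

Section Pairs.
Variables (k : fieldType) (r : nat) (V : lmodType k).
Hypothesis char0 : [pchar k] =i pred0.
Implicit Type L : seq ('rV[int]_r * V).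

(** For an [m] that is no exponent of [L] the sum is empty, and [W 0] settles that case. *)
Lemma mon_independent_mod_pairs (W : V -> Prop) L :
  W 0 -> (forall (c : k) v w, W v -> W w -> W (c *: v + w)) ->
  (forall t : 'I_r -> k, in_torus t -> W (\sum_(p <- L) mon t p.1 *: p.2)) ->
  forall m, W (\sum_(p <- L | p.1 == m) p.2).
Proof.
move=> W0 Wlin WL m; case mL: (m \in undup (map fst L)).
  apply: (mon_independent_mod char0 (x := fun m => \sum_(p <- L | p.1 == m) p.2)
    Wlin (undup_uniq (map fst L))) mL => t tT.
  by rewrite -sum_group; apply: WL.
rewrite big_seq_cond big_pred0 // => p; apply: contraFF mL => /andP [pL /eqP <-].
by rewrite mem_undup map_f.
Qed.

Lemma mon_independent_pairs L :
  (forall t : 'I_r -> k, in_torus t -> \sum_(p <- L) mon t p.1 *: p.2 = 0) ->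
  forall m, \sum_(p <- L | p.1 == m) p.2 = 0.
Proof.
apply: (mon_independent_mod_pairs (W := eq^~ 0)) => // c v w -> ->.
by rewrite scaler0 addr0.
Qed.

(** Adjoining the pair [(n, - a)] turns the hypothesis into a vanishing sum, whose part of exponent
    [n] must then be zero. *)
Lemma weight_part L n a :
  (forall t : 'I_r -> k, in_torus t -> \sum_(p <- L) mon t p.1 *: p.2 = mon t n *: a) ->
  a = \sum_(p <- L | p.1 == n) p.2.
Proof.
move=> La; have := @mon_independent_pairs ((n, - a) :: L) _ n.
rewrite big_cons /= eqxx => La0; apply/eqP; rewrite eq_sym -subr_eq0 addrC La0 //.
by move=> t tT; rewrite big_cons /= La // scalerN addNr.
Qed.

End Pairs.

(** * Matrices of automorphisms and weights of torus actions *)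

Section Automorphisms.
Variables (k : fieldType) (A : algType k).
Implicit Types f g : A -> A.

Lemma autZ f (c : k) (x : A) : is_aut f -> f (c *: x) = c *: f x.
Proof.
move=> [flin _ _ _]; have f0 : f 0 = 0.
  by have := flin (-1) 0 0; rewrite !scaleN1r !addNr.
by have := flin c x 0; rewrite f0 !addr0.
Qed.

Lemma aut_sum f (I : Type) (l : seq I) (P : pred I) (x : I -> A) :
  is_aut f -> f (\sum_(i <- l | P i) x i) = \sum_(i <- l | P i) f (x i).
Proof.
move=> fA; apply: big_morph => [u v|].
  by have [flin _ _ _] := fA; have := flin 1 u v; rewrite !scale1r.
by have := autZ 0 0 fA; rewrite !scale0r.
Qed.

Section Representation.
Variables (d : nat) (b : 'I_d -> A).

Lemma rep_unique f M N : lin_free b -> rep b f M -> rep b f N -> M = N.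
Proof.
move=> bfree fM fN; apply/matrixP => i j; apply/eqP; rewrite -subr_eq0; apply/eqP.
apply: (bfree (fun j => M i j - N i j)).
under eq_bigr do rewrite scalerBl.
by rewrite sumrB -fM -fN subrr.
Qed.

Lemma rep_id : rep b id 1%:M.
Proof.
move=> i; rewrite (bigD1 i) //= mxE eqxx scale1r big1 ?addr0 // => j /negPf ji.
by rewrite mxE eq_sym ji scale0r.
Qed.

(** Images of basis vectors are stored as rows, so composition reverses the order of the matrix
    product. *)
Lemma rep_comp f g M N : is_aut f -> rep b f M -> rep b g N ->
  rep b (f \o g) (N *m M).
Proof.
move=> fA fM gN i; rewrite /= gN (aut_sum _ _ _ fA).
transitivity (\sum_j \sum_l (N i j * M j l) *: b l).
  apply: eq_bigr => j _; rewrite autZ // fM scaler_sumr.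
  by apply: eq_bigr => l _; rewrite scalerA.
by rewrite exchange_big; apply: eq_bigr => l _; rewrite mxE scaler_suml.
Qed.

End Representation.

Section Action.
Variables (r : nat) (sigma : ('I_r -> k) -> A -> A).
Hypothesis char0 : [pchar k] =i pred0.
Hypothesis sigma_aut : forall t, in_torus t -> is_aut (sigma t).
Hypothesis sigmaM : forall t s, in_torus t -> in_torus s ->
  sigma (tmul t s) = sigma t \o sigma s.

(** The map at the identity is idempotent by multiplicativity and injective as an automorphism. *)
Lemma action1 : sigma (fun=> 1) = id.
Proof.
have [_ _ _ sigma1_bij] := sigma_aut (@in_torus1 k r).
apply: functional_extensionality => x; apply: (bij_inj sigma1_bij).
by have := congr1 (@^~ x) (sigmaM (@in_torus1 k r) (@in_torus1 k r)); rewrite tmul1.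
Qed.

(* The determinant is a regular character, hence a monomial, so dividing by its
   powers preserves regularity. *)
Lemma regular_matrix_coef (d : nat) (b : 'I_d -> A) (M : ('I_r -> k) -> 'M[k]_d)
    (p : {mpoly k[d * d]}) (N : nat) :
  lin_free b -> (forall t, in_torus t -> rep b (sigma t) (M t)) ->
  (forall i j, regular_torus (fun t => M t i j)) ->
  regular_torus (fun t => p.@[mxv (M t)] / \det (M t) ^+ N).
Proof.
move=> bfree sigmaE Mreg.
have M1 : M (fun=> 1) = 1%:M.
  apply: (rep_unique bfree (sigmaE _ (@in_torus1 k r))).
  by rewrite action1; apply: rep_id.
have MM t s : in_torus t -> in_torus s -> \det (M (tmul t s)) = \det (M t) * \det (M s).
  move=> tT sT; rewrite mulrC -det_mulmx; congr (\det _).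
  apply: (rep_unique bfree (sigmaE _ (in_torusM tT sT))).
  by rewrite sigmaM //; apply: rep_comp; auto.
have [|m detE] := regular_character char0 (regular_det Mreg) MM.
  by rewrite M1 det1 oner_eq0.
apply: (@regular_ext _ _ (fun t => p.@[mxv (M t)] * mon t (- m) ^+ N)).
  move=> t tT; rewrite detE // -exprVn; congr (_ * _ ^+ _).
  apply: (mulfI (mon_neq0 m tT)).
  by rewrite -monD // subrr mon0 divff // mon_neq0.
apply: regularM; first exact: regular_meval_mxv.
by apply: regularX; apply: regular_mon.
Qed.

(** The Laurent coefficients of the orbit map of [a] do it: comparing coefficients in [s] in the
    action law for [tmul t s] shows that they are weight vectors, and at the identity they add up to
    [a]. *)
Lemma weight_decomposition a : laurent (sigma^~ a) ->
  exists (l : seq 'rV[int]_r) (x : 'rV[int]_r -> A),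
    [/\ uniq l, forall m, m \in l -> canon_comp sigma m (x m)
      & a = \sum_(m <- l) x m].
Proof.
move=> /laurentP [l [x [ul aE]]]; exists l, x; split=> // [m ml t tT|].
  apply/eqP; rewrite -subr_eq0; apply/eqP.
  apply: (mon_independent char0 (x := fun m => sigma t (x m) - mon t m *: x m) ul _ ml).
  move=> s sT; have := congr1 (@^~ a) (sigmaM tT sT).
  rewrite /= (aE _ (in_torusM tT sT)) (aE s sT) (aut_sum _ _ _ (sigma_aut tT)).
  move/eqP; rewrite eq_sym -subr_eq0 -sumrB => /eqP S0; rewrite -[RHS]S0.
  apply: eq_bigr => n _; rewrite scalerBr [sigma t (_ *: _)]autZ; last exact: sigma_aut.
  by rewrite scalerA monM mulrC.
have := aE _ (@in_torus1 k r); rewrite action1 => {1}->.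
by apply: eq_bigr => m _; rewrite mon1 scale1r.
Qed.

End Action.
End Automorphisms.

(** * The torus action attached to a grading *)

Section Grading.
Variables (k : fieldType) (A : algType k) (t : nat) (G : 'rV[int]_t -> A -> Prop).
Hypothesis hG : is_grading G.
Implicit Types (L : seq ('rV[int]_t * A)) (s : 'I_t -> k).

Definition homogeneous L := forall p, p \in L -> G p.1 p.2.

Lemma homog_cat L L' : homogeneous L -> homogeneous L' -> homogeneous (L ++ L').
Proof. by move=> hL hL' p; rewrite mem_cat => /orP [/hL|/hL']. Qed.

Lemma grading0 n : G n 0.
Proof. by have [G0 _ _ _ _] := hG. Qed.

Lemma gradingZ n c x : G n x -> G n (c *: x).
Proof.
have [_ Glin _ _ _] := hG => Gx; rewrite -[_ *: _]addr0.
by apply: Glin => //; apply: grading0.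
Qed.

Lemma grading_sum n (I : eqType) (l : seq I) (P : pred I) (x : I -> A) :
  (forall i, i \in l -> P i -> G n (x i)) -> G n (\sum_(i <- l | P i) x i).
Proof.
have [_ Glin _ _ _] := hG => Gx; rewrite big_seq_cond.
apply: big_ind => [|u v Gu Gv|i /andP [il Pi]]; first exact: grading0.
  by rewrite -[u]scale1r; apply: Glin.
exact: Gx.
Qed.

(** Directness of the grading kills the part of each degree separately, so rescaling by degree keeps
    the sum zero. This is what makes the action below well defined. *)
Lemma homog_sum0 L (h : 'rV[int]_t -> k) : homogeneous L -> \sum_(p <- L) p.2 = 0 ->
  \sum_(p <- L) h p.1 *: p.2 = 0.
Proof.
have [_ _ _ _ Gindep] := hG => hL L0; rewrite sum_group big_seq big1 // => n nL.
suff -> : \sum_(p <- L | p.1 == n) p.2 = 0 by rewrite scaler0.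
apply: (Gindep _ (fun n => \sum_(p <- L | p.1 == n) p.2) (undup_uniq _) _ _ _ nL).
  by move=> m _; apply: grading_sum => p pL /eqP <-; apply: hL.
rewrite -[RHS]L0; under [RHS]eq_bigr do rewrite -[_.2](scale1r (R := k)).
rewrite [RHS](sum_group L fst (fun=> 1) snd); apply: eq_bigr => m _.
by rewrite scale1r.
Qed.

(** The grading only asserts existence; choosing a decomposition for each element lets the action be
    defined as a function. *)
Lemma homog_decomposition a : {L | homogeneous L & a = \sum_(p <- L) p.2}.
Proof.
suff /constructive_indefinite_description [L [hL aE]] :
  exists L, homogeneous L /\ a = \sum_(p <- L) p.2 by exists L.
have [_ _ _ /(_ a) [l [f [_ Gf ->]]] _] := hG.
exists [seq (n, f n) | n <- l]; rewrite big_map; split=> // p /mapP [n nl ->].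
exact: Gf.
Qed.

Definition parts a : seq ('rV[int]_t * A) := s2val (homog_decomposition a).

Lemma parts_homog a : homogeneous (parts a).
Proof. exact: s2valP. Qed.

Lemma parts_sum a : a = \sum_(p <- parts a) p.2.
Proof. exact: (s2valP' (homog_decomposition a)). Qed.

Definition grading_action s a : A := \sum_(p <- parts a) mon s p.1 *: p.2.
Local Notation rho := grading_action.

(** Independence of the chosen decomposition: [homog_sum0] is applied to [parts a] followed by the
    negatives of [L]. The algebraic laws of the action then follow by picking convenient
    decompositions. *)
Lemma grading_actionE s a L : homogeneous L -> a = \sum_(p <- L) p.2 ->
  rho s a = \sum_(p <- L) mon s p.1 *: p.2.
Proof.
move=> hL aE; pose L' := [seq (p.1, - p.2) | p <- L].
have hL' : homogeneous L'.
  by move=> _ /mapP [p pL ->] /=; rewrite -scaleN1r; apply/gradingZ/hL.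
have := homog_sum0 (mon s) (homog_cat (@parts_homog a) hL').
rewrite !big_cat !big_map /= sumrN -parts_sum -aE subrr => /(_ erefl)/eqP.
under [X in _ + X == _]eq_bigr do rewrite scalerN.
by rewrite sumrN subr_eq0 => /eqP.
Qed.

Lemma grading_action_homog s n a : G n a -> rho s a = mon s n *: a.
Proof.
move=> Ga; rewrite (@grading_actionE s a [:: (n, a)]) ?big_seq1 //.
by move=> p; rewrite inE => /eqP ->.
Qed.

(** The grading is recovered from its action: by [weight_part], an element of weight [n] equals the
    degree [n] part of its own decomposition. *)
Lemma grading_actionP n a : [pchar k] =i pred0 ->
  (forall s, in_torus s -> rho s a = mon s n *: a) <-> G n a.
Proof.
move=> char0; split=> [|Ga s _]; last exact: grading_action_homog.
move=> /(weight_part char0) ->.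
by apply: grading_sum => p pL /eqP <-; apply: parts_homog pL.
Qed.

Lemma grading_action_lin s c x y : rho s (c *: x + y) = c *: rho s x + rho s y.
Proof.
rewrite (@grading_actionE s _ ([seq (p.1, c *: p.2) | p <- parts x] ++ parts y)).
- rewrite big_cat big_map scaler_sumr; congr (_ + _); apply: eq_bigr => p _ /=.
  by rewrite !scalerA mulrC.
- apply: homog_cat (@parts_homog y) => _ /mapP [p pL ->].
  by apply: gradingZ; apply: parts_homog pL.
- by rewrite big_cat big_map -scaler_sumr -!parts_sum.
Qed.

Lemma grading_actionM s x y : in_torus s -> rho s (x * y) = rho s x * rho s y.
Proof.
move=> sT; have [_ _ GM _ _] := hG.
pose mulp (p q : 'rV[int]_t * A) := (p.1 + q.1, p.2 * q.2).
(* Stated for any multiplicative [h] because it serves twice: with [mon s] for the action, and with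
   the constant 1 to see that the products of parts sum to [x * y]. *)
have mulpE (h : 'rV[int]_t -> k) :
    (forall m n, h (m + n) = h m * h n) ->
  \sum_(p <- allpairs mulp (parts x) (parts y)) h p.1 *: p.2 =
  (\sum_(p <- parts x) h p.1 *: p.2) * (\sum_(p <- parts y) h p.1 *: p.2).
  move=> hM; rewrite big_allpairs_dep mulr_suml; apply: eq_bigr => p _.
  rewrite mulr_sumr; apply: eq_bigr => q _ /=.
  by rewrite hM -scalerAl -scalerAr scalerA.
rewrite (@grading_actionE s _ (allpairs mulp (parts x) (parts y))).
- by apply: mulpE => m n; apply: monD.
- move=> _ /allpairsP [[p q] /= [pL qL ->]].
  by apply: GM; [apply: parts_homog pL | apply: parts_homog qL].
- have sum1 L : \sum_(p <- L) (1 : k) *: p.2 = \sum_(p <- L) p.2.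
    by apply: eq_bigr => p _; rewrite scale1r.
  have /= := mulpE (fun=> 1) (fun _ _ => esym (mulr1 1)).
  by rewrite !sum1 -!parts_sum.
Qed.

Lemma grading_action1 : rho (fun=> 1) = id.
Proof.
apply: functional_extensionality => x; rewrite [RHS]parts_sum.
by apply: eq_bigr => p _; rewrite mon1 scale1r.
Qed.

Lemma grading_action_tmul s s' : rho (tmul s s') = rho s \o rho s'.
Proof.
apply: functional_extensionality => x.
rewrite /= (@grading_actionE s _ [seq (p.1, mon s' p.1 *: p.2) | p <- parts x]).
- by rewrite big_map; apply: eq_bigr => p _ /=; rewrite scalerA monM.
- by move=> _ /mapP [p pL ->]; apply: gradingZ; apply: parts_homog pL.
- by rewrite big_map.
Qed.

Lemma grading_action_aut s : in_torus s -> is_aut (rho s).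
Proof.
move=> sT; have rhoK x y : tmul x y = (fun=> 1) -> cancel (rho y) (rho x).
  move=> xy z; rewrite -[LHS]/((rho x \o rho y) z).
  by rewrite -grading_action_tmul xy grading_action1.
have rhoVK : cancel (rho s) (rho (fun i => (s i)^-1)).
  by apply: rhoK; rewrite tmulC tmulV.
have rhoKV : cancel (rho (fun i => (s i)^-1)) (rho s) by apply: rhoK; apply: tmulV.
split; [exact: grading_action_lin | by move=> x y; apply: grading_actionM | |].
  (* The right factor 1 is written as the image of some [z]; then [rho s 1 * rho s z = rho s (1 * z)
     = rho s z = 1]. *)
  rewrite -[LHS]mulr1 -{2}(rhoKV 1) -grading_actionM // mul1r.
  exact: rhoKV.
by exists (rho (fun i => (s i)^-1)).
Qed.

(** * The action of a grading lands in the identity component *)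

Section Representation.
Hypothesis char0 : [pchar k] =i pred0.
Variables (d : nat) (b : 'I_d -> A).
Hypothesis bfree : lin_free b.
Hypothesis binv : forall f, is_aut f -> exists M, rep b f M.

Lemma in_span_lin (c : k) v w : in_span b v -> in_span b w -> in_span b (c *: v + w).
Proof.
move=> [e ->] [e' ->]; exists (fun i => c * e i + e' i).
rewrite scaler_sumr -big_split; apply: eq_bigr => i _ /=.
by rewrite scalerDl scalerA.
Qed.

(* V being invariant under rho is a graded subspace, by independence of
   characters modulo V. *)
Lemma grading_action_rep : exists M : ('I_t -> k) -> 'M[k]_d,
  (forall i j, regular_torus (fun s => M s i j)) /\
  forall s, in_torus s -> rep b (rho s) (M s).
Proof.
pose y i n := \sum_(p <- parts (b i) | p.1 == n) p.2.
have yV i n : {c : 'I_d -> k | y i n = \sum_j c j *: b j}.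
  apply: constructive_indefinite_description.
  apply: (mon_independent_mod_pairs char0 (W := in_span b)) => [|c v w|s sT].
  - by exists (fun=> 0); rewrite big1 // => j _; rewrite scale0r.
  - exact: in_span_lin.
  - by have [M /(_ i) Mi] := binv (grading_action_aut sT); exists (M i).
(* Expanding each homogeneous part of [b i] in terms of [b] displays every matrix entry as a Laurent
   polynomial in [s]. *)
exists (fun s => \matrix_(i, j) \sum_(n <- undup (map fst (parts (b i))))
  mon s n * sval (yV i n) j); split=> [i j|s sT i].
  apply: (@regular_ext _ _ (fun s => \sum_(n <- undup (map fst (parts (b i))))
    mon s n * sval (yV i n) j)) => [s _|]; first by rewrite mxE.
  apply: regular_sum => n; apply: regularM; [exact: regular_mon | exact: regular_cst].
rewrite /grading_action sum_group.
under eq_bigr => n _ do rewrite -/(y i n) (svalP (yV i n)) scaler_sumr.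
rewrite exchange_big; apply: eq_bigr => j _ /=.
by rewrite mxE scaler_suml; apply: eq_bigr => n _; rewrite scalerA.
Qed.

(** The connected set through [id] is the whole image of the torus. If neither closed set contained
    it, each would have an equation failing somewhere on the torus; by [regular_nonvanishing] both
    fail at a common point, which the two sets do not cover. *)
Lemma grading_action_aut0 s : in_torus s -> in_aut0 b (rho s).
Proof.
move=> sT; have [M [Mreg rhoM]] := grading_action_rep.
exists (fun g => exists2 s, in_torus s & g = rho s); split; last by exists s.
- by move=> _ [s' s'T ->]; apply: grading_action_aut.
- by exists (fun=> 1); [exact: in_torus1 | rewrite grading_action1].
move=> Z1 Z2 [S1 Z1E] [S2 Z2E] cover _.
have witness (Z : (A -> A) -> Prop) (S : {mpoly k[d * d]} -> Prop) :
    (forall f, is_aut f ->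
      Z f <-> forall N, rep b f N -> forall p, S p -> p.@[mxv N] = 0) ->
    ~ (forall f, (exists2 s, in_torus s & f = rho s) -> Z f) ->
  exists s p, [/\ in_torus s, S p & p.@[mxv (M s)] != 0].
  move=> ZE notZ; apply: NNPP => none; apply: notZ => _ [s' s'T ->].
  apply/(ZE _ (grading_action_aut s'T)) => N rhoN p Sp.
  rewrite -(rep_unique bfree (rhoM _ s'T) rhoN).
  by apply/eqP/negP => /negP ps'; apply: none; exists s', p.
have [?|/(witness _ _ Z1E) [s1 [p1 [s1T Sp1 p1s1]]]] :=
  classic (forall f, (exists2 s, in_torus s & f = rho s) -> Z1 f).
  by left.
have [?|/(witness _ _ Z2E) [s2 [p2 [s2T Sp2 p2s2]]]] :=
  classic (forall f, (exists2 s, in_torus s & f = rho s) -> Z2 f).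
  by right.
have [u [uT p1u p2u]] := regular_nonvanishing char0 (regular_meval_mxv p1 Mreg)
  (regular_meval_mxv p2 Mreg) s1T s2T p1s1 p2s2.
have uA := grading_action_aut uT; have := cover (rho u).
case; first by exists u.
  by move/(Z1E _ uA)/(_ _ (rhoM _ uT) _ Sp1)/eqP; rewrite (negPf p1u).
by move/(Z2E _ uA)/(_ _ (rhoM _ uT) _ Sp2)/eqP; rewrite (negPf p2u).
Qed.

End Representation.
End Grading.

(** The rows of [V] define a homomorphism of tori; pulling characters back along it is right
    multiplication by [V], which becomes the degree map of the theorem. *)
Lemma mon_mulmx (k : fieldType) (r t : nat) (s : 'I_t -> k) (V : 'M[int]_(r, t))
    (m : 'rV[int]_r) : in_torus s ->
  mon (fun i => mon s (row i V)) m = mon s (m *m V).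
Proof.
move=> sT; have expz_sum (x : k) (z : 'I_r -> int) : x != 0 ->
    x ^ (\sum_i z i) = \prod_i x ^ z i.
  by move=> x0; apply: big_morph => // u v; rewrite expfzDr.
transitivity (\prod_i \prod_j s j ^ (m 0 i * V i j)).
  apply: eq_bigr => i _.
  rewrite (big_morph (fun x => x ^ m 0 i) (id1 := 1) (op1 := *%R)).
  - by apply: eq_bigr => j _; rewrite mxE mulrC exprz_exp.
  - by move=> x y; apply: expfzMl.
  - exact: exp1rz.
rewrite exchange_big; apply: eq_bigr => j _.
by rewrite mxE expz_sum.
Qed.

(** * Factoring the action of a grading through the canonical torus *)

Section FewAutomorphisms.
Variables (k : fieldType) (A : algType k).
Hypothesis char0 : [pchar k] =i pred0.
Variables (d : nat) (b : 'I_d -> A) (r : nat) (psi : ('I_r -> k) -> A -> A).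
Hypothesis hfew : few_automorphisms b psi.

Lemma few_torus_aut t : in_torus t -> is_aut (psi t).
Proof.
have [_ _ _ [[psi0 _] _ _ _ _]] := hfew.
by move=> /psi0 [C [Caut _ _ /Caut]].
Qed.

Lemma few_torus_mul t s : in_torus t -> in_torus s ->
  psi (tmul t s) = psi t \o psi s.
Proof. by have [_ _ _ [_ _ psiM _ _]] := hfew; apply: psiM. Qed.

(** Rationality places [a] in a finite dimensional invariant space where the matrix coefficients are
    regular on automorphisms; [regular_matrix_coef] makes them regular on the torus after
    composition with [psi]. *)
Lemma few_torus_laurent a : laurent (psi^~ a).
Proof.
have [[bfree _] _ rational [_ _ _ [F [Freg psiF]] _]] := hfew.
have [e [c [E [_ [alpha ->] Ereg psiE]]]] := rational a.
have Mreg i j : regular_torus (fun t => (\matrix_(i, j) F i j t : 'M[k]_d) i j).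
  by apply: regular_ext (Freg i j) => t _; rewrite mxE.
have Epsi i j : regular_torus (fun t => E i j (psi t)).
  have [p [N EE]] := Ereg i j.
  apply: regular_ext
    (regular_matrix_coef char0 few_torus_aut few_torus_mul p N bfree psiF Mreg).
  by move=> t tT; rewrite (EE _ _ (few_torus_aut tT) (psiF t tT)).
have [L LE] : laurent (fun t => \sum_i \sum_j E i j (psi t) *: (alpha i *: c j)).
  by apply: laurent_sum => i; apply: laurent_sum => j; apply: laurent_regular.
exists L => t tT; have tA := few_torus_aut tT.
rewrite -LE // aut_sum //; apply: eq_bigr => i _.
rewrite autZ // psiE // scaler_sumr; apply: eq_bigr => j _.
by rewrite !scalerA mulrC.
Qed.

Lemma few_weight_decomposition a :
  exists (l : seq 'rV[int]_r) (x : 'rV[int]_r -> A),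
    [/\ uniq l, forall m, m \in l -> canon_comp psi m (x m)
      & a = \sum_(m <- l) x m].
Proof.
exact: weight_decomposition char0 few_torus_aut few_torus_mul _ (few_torus_laurent a).
Qed.

Section Grading.
Variables (t : nat) (G : 'rV[int]_t -> A -> Prop).
Hypothesis hG : is_grading G.

(* The coordinates of the torus element inducing rho(s) are regular characters
   of s, hence monomials; their exponents are the rows of V. *)
Lemma grading_action_factor : exists V : 'M[int]_(r, t),
  forall s, in_torus s ->
    in_torus (fun i => mon s (row i V)) /\
    grading_action hG s = psi (fun i => mon s (row i V)).
Proof.
have [[bfree [binv _]] _ _ [[_ psi_surj] psi_inj psiM _ [H [Hreg HK]]]] := hfew.
have rho0 s (sT : in_torus s) := grading_action_aut0 hG char0 bfree binv sT.
(* [H] is the regular inverse of [psi], so [tau] reads off the torus coordinates of the action at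
   [s]. *)
pose tau s i := H i (grading_action hG s).
have tauP s : in_torus s -> in_torus (tau s) /\ psi (tau s) = grading_action hG s.
  move=> sT; have [u uT uE] := psi_surj _ (rho0 s sT).
  suff -> : tau s = u by [].
  by apply: functional_extensionality => i; rewrite /tau -uE HK.
have tauM s s' : in_torus s -> in_torus s' -> tau (tmul s s') = tmul (tau s) (tau s').
  move=> sT s'T; have [tsT tsE] := tauP _ sT; have [ts'T ts'E] := tauP _ s'T.
  have [tssT tssE] := tauP _ (in_torusM sT s'T).
  (* Both sides induce the same automorphism, and [psi] is injective on the torus. *)
  apply: psi_inj => //; first exact: in_torusM.
  by rewrite tssE psiM // tsE ts'E grading_action_tmul.
have [M [Mreg rhoM]] := grading_action_rep hG char0 binv.
have tau_reg i : regular_torus (tau^~ i).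
  have [p [N HE]] := Hreg i.
  apply: regular_ext (regular_matrix_coef char0 (grading_action_aut hG)
    (fun s s' _ _ => grading_action_tmul hG s s') p N bfree rhoM Mreg) => s sT.
  by rewrite /tau (HE _ _ (rho0 s sT) (rhoM s sT)).
have tau_mon i : {m | forall s, in_torus s -> tau s i = mon s m}.
  apply: constructive_indefinite_description.
  apply: (regular_character char0 (tau_reg i)).
    by move=> s s' sT s'T; rewrite tauM.
  by have [tau1T _] := tauP _ (@in_torus1 k t).
exists (\matrix_i sval (tau_mon i)) => s sT.
suff <- : tau s = fun i => mon s (row i (\matrix_i sval (tau_mon i))).
  by have [? ->] := tauP _ sT.
by apply: functional_extensionality => i; rewrite (svalP (tau_mon i)) // rowK.
Qed.

End Grading.
End FewAutomorphisms.

(** * Comparison of an arbitrary grading with the canonical one *)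

Theorem theorem2p2 (k : fieldType) (A : algType k)
    (char0 : [pchar k] =i pred0)
    (d : nat) (b : 'I_d -> A) (r : nat) (psi : ('I_r -> k) -> A -> A)
    (hfew : few_automorphisms b psi)
    (t : nat) (G : 'rV[int]_t -> A -> Prop) (hG : is_grading G) :
  exists phi : 'rV[int]_r -> 'rV[int]_t,
    (forall x y, phi (x + y) = phi x + phi y) /\
    forall n : 'rV[int]_t,
      (forall a : A, G n a <->
         exists (s : seq 'rV[int]_r) (f : 'rV[int]_r -> A),
           [/\ uniq s,
               forall m, m \in s -> phi m = n /\ canon_comp psi m (f m)
             & a = \sum_(m <- s) f m])
      /\ (forall (s : seq 'rV[int]_r) (f : 'rV[int]_r -> A), uniq s ->
            (forall m, m \in s -> phi m = n /\ canon_comp psi m (f m)) ->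
            \sum_(m <- s) f m = 0 -> forall m, m \in s -> f m = 0).
Proof.
have [V rhoE] := grading_action_factor char0 hfew hG.
(* The action of the grading is scalar on each canonical component, with character [m *m V] on the
   component of [m]. *)
have rho_sum s (l : seq 'rV[int]_r) (x : 'rV[int]_r -> A) : in_torus s ->
    (forall m, m \in l -> canon_comp psi m (x m)) ->
  grading_action hG s (\sum_(m <- l) x m) = \sum_(m <- l) mon s (m *m V) *: x m.
  move=> sT xW; have [uT ->] := rhoE s sT.
  rewrite aut_sum; last exact: (few_torus_aut hfew).
  rewrite big_seq [RHS]big_seq; apply: eq_bigr => m ml.
  by rewrite (xW m ml _ uT) -mon_mulmx.
exists (mulmx^~ V); split=> [x y|n]; first exact: mulmxDl.
split=> [a|l x ul xW x0 m ml]; first split.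
- move=> /(grading_actionP hG n a char0) aW.
  have [l [x [ul xW aE]]] := few_weight_decomposition char0 hfew a.
  exists [seq m <- l | m *m V == n], x; split; first exact: filter_uniq.
    by move=> m; rewrite mem_filter => /andP [/eqP -> /xW].
  (* Relabelled by [m *m V], the canonical parts of [a] expand its orbit under the action; since [a]
     has weight [n], only the parts labelled [n] contribute to it. *)
  rewrite big_filter
    (weight_part char0 (L := [seq (m *m V, x m) | m <- l]) (n := n) (a := a)).
    by rewrite big_map.
  by move=> s sT; rewrite big_map -aW // aE rho_sum.
- move=> [l [x [ul xW ->]]]; apply/(grading_actionP hG n _ char0) => s sT.
  rewrite rho_sum // => [|m /xW [] //].
  by rewrite scaler_sumr big_seq [RHS]big_seq; apply: eq_bigr => m /xW [-> _].
(* Directness: applying [psi u] to the zero sum yields a relation between distinct characters with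
   coefficients [x m]. *)
apply: (mon_independent char0 ul _ ml) => u uT.
have uA := few_torus_aut hfew uT.
transitivity (psi u (\sum_(m <- l) x m)); last first.
  by rewrite x0; have := autZ 0 0 uA; rewrite !scale0r.
rewrite aut_sum //.
rewrite big_seq [RHS]big_seq; apply: eq_bigr => m' /xW [_ m'W].
by rewrite m'W.
Qed.
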